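(* There exists a dynamical system $(X,f)$ satisfying the non-uniform $\infty$-specification property for which there exist two distinct ergodic measures $\mu,\nu\in\mathcal{M}_f^{erg}(X)$ such that $G^\mu\setminus G^\nu$ has no DC1-scrambled pairs (that is, no $x,y\in G^\mu\setminus G^\nu$ form a DC1-scrambled pair $\{x,y\}$).
   Context: A dynamical system $(X,f)$ consists of a compact metric space $(X,d)$ with at least two points and a continuous map $f:X\to X$. $\mathbb{N}$ denotes the positive integers. $\mathcal{M}_f^{erg}(X)$ is the set of $f$-ergodic ($f$-invariant) Borel probability measures on $X$; measures carry the weak* topology. Non-uniform specification property: $(X,f)$ satisfies the non-uniform specification property with gap function $M(n,\varepsilon):\mathbb{N}\times(0,+\infty)\to\mathbb{N}$ if (i) $M(n,\varepsilon)$ is non-decreasing in $n$ and non-increasing in $\varepsilon$; (ii) for every $\varepsilon>0$, any integer $k\ge2$, any $x_1,\dots,x_k\in X$ and any non-negative integers $a_1\le b_1<a_2\le b_2<\cdots<a_k\le b_k$ with $a_{i+1}-b_i\ge M(b_i-a_i+1,\varepsilon)$ for $1\le i\le k-1$, there exists $z\in X$ such that $d(f^{n-a_i}x_i,f^nz)\le\varepsilon$ for all $a_i\le n\le b_i$ and $1\le i\le k$. Non-uniform $\tau$-specification property ($\tau\in[0,\infty]$): let $\mathscr{G}(X,f)$ be the collection of all gap functions for which $(X,f)$ satisfies the non-uniform specification property, and for $M\in\mathscr{G}(X,f)$ let $\tau(M)=\sup_{\varepsilon>0}\liminf_{n\to\infty}\frac{M(n,\varepsilon)}{n}\in[0,\infty]$.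 $(X,f)$ satisfies the non-uniform $\tau$-specification property if there is $M\in\mathscr{G}(X,f)$ with $\tau(M)=\tau$ and every $M'\in\mathscr{G}(X,f)$ satisfies $\tau(M')\ge\tau$. (For $\tau=\infty$: $\mathscr{G}(X,f)\ne\varnothing$ and every $M\in\mathscr{G}(X,f)$ has $\tau(M)=\infty$.) For $x\in X$ and $n\in\mathbb{N}$ let $\delta_x^n=\frac1n\sum_{k=0}^{n-1}\delta_{f^kx}$, and let $V_f(x)$ be the set of weak* accumulation points of $\{\delta_x^n\}_{n\ge1}$. For an invariant measure $\mu$, $G^{\mu}=\{x\in X:\mu\in V_f(x)\}$. A pair $\{x,y\}$ is DC1-scrambled if for every $t>0$, $\limsup_{n\to\infty}\frac1n|\{j\in[0,n-1]:d(f^jx,f^jy)<t\}|=1$, and there exists $t_0>0$ such that $\liminf_{n\to\infty}\frac1n|\{j\in[0,n-1]:d(f^jx,f^jy)<t_0\}|=0$ (here $j$ ranges over integers). *)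

(* Defs.v *)
From HB Require Import structures.
From mathcomp Require Import all_boot all_order all_algebra.
From mathcomp Require Import all_classical all_reals all_analysis.

Set Implicit Arguments.
Unset Strict Implicit.
Unset Printing Implicit Defensive.

Import Order.TTheory GRing.Theory Num.Theory.
Import numFieldNormedType.Exports.

Local Open Scope classical_set_scope.
Local Open Scope ring_scope.

(* The base point carries no mathematical content: measurable types are
   required to be pointed. *)
#[short(type="pmetricType")]
HB.structure Definition PointedMetric (K : numDomainType) :=
  { M of Metric K M & Pointed M }.

Definition dynamical_system (R : realType) (X : pmetricType R)
    (f : X -> X) : Prop :=
  [/\ compact [set: X], exists x y : X, x <> y & continuous f].

(* A gap function is a map from pairs (n, eps) with 0 < n and 0 < eps to the
   positive integers.  It is encoded as a total function, whose values at other
   arguments are irrelevant: every condition below is restricted to 0 < n and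
   0 < eps, and [gap_rate] only depends on such values. *)
Definition gap_function (R : realType) (M : nat -> R -> nat) : Prop :=
  [/\ forall n eps, (0 < n)%N -> 0 < eps -> (0 < M n eps)%N,
      forall m n eps, (0 < m)%N -> (m <= n)%N -> 0 < eps ->
        (M m eps <= M n eps)%N &
      forall n eps1 eps2, (0 < n)%N -> 0 < eps1 -> eps1 <= eps2 ->
        (M n eps2 <= M n eps1)%N].

(* The points and times are indexed by 0, ..., k - 1. *)
Definition nonuniform_specification (R : realType) (X : pmetricType R)
    (f : X -> X) (M : nat -> R -> nat) : Prop :=
  gap_function M /\
  forall (eps : R) (k : nat) (x : nat -> X) (a b : nat -> nat),
    0 < eps -> (2 <= k)%N ->
    (forall i, (i < k)%N -> (a i <= b i)%N) ->
    (forall i, (i.+1 < k)%N -> (b i < a i.+1)%N) ->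
    (forall i, (i.+1 < k)%N ->
      (M (b i - a i + 1)%N eps <= a i.+1 - b i)%N) ->
    exists z : X, forall i n, (i < k)%N -> (a i <= n <= b i)%N ->
      mdist (iter (n - a i) f (x i)) (iter n f z) <= eps.

Definition gap_rate (R : realType) (M : nat -> R -> nat) : \bar R :=
  ereal_sup [set limn_einf (fun n => ((M n eps)%:R / n%:R)%:E)
            | eps in [set eps : R | 0 < eps]].

Definition nonuniform_tau_specification (R : realType) (X : pmetricType R)
    (f : X -> X) (tau : \bar R) : Prop :=
  (exists M, nonuniform_specification f M /\ gap_rate M = tau) /\
  (forall M, nonuniform_specification f M -> (tau <= gap_rate M)%E).

Definition borel (R : realType) (X : pmetricType R) :
    measurableType (@open X).-sigma :=
  g_sigma_algebraType (@open X).

(* The weak* topology is the coarsest one making mu |-> \int phi dmu continuous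
   for all continuous phi : X -> R. *)
Definition integral_functional (R : realType) (X : pmetricType R)
    (mu : probability (borel X) R) : {ptws continuousType X R -> R} :=
  fun phi => \int[mu]_x phi x.

Definition weak_star (R : realType) (X : pmetricType R) : topologicalType :=
  initial_topology (@integral_functional R X).

(* [empirical f x n] averages over the first n + 1 iterates, so that it is a
   probability measure for every n : nat. *)
Section empirical.
Context (R : realType) (X : pmetricType R) (f : X -> X) (x : X) (n : nat).

Definition empirical : set (borel X) -> \bar R :=
  mscale (n.+1%:R^-1)%:nng
    (msum (fun k => \d_(iter k f x : borel X)) n.+1).

HB.instance Definition _ := Measure.on empirical.

Let empirical_setT : empirical setT = 1%E.
Proof.
rewrite /empirical /mscale /= /msum (eq_bigr (fun=> 1%E)); last first.
  by move=> i _; exact: diracT.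
by rewrite sumEFin sumr_const card_ord -EFinM mulVf.
Qed.

HB.instance Definition _ :=
  Measure_isProbability.Build _ _ _ empirical empirical_setT.

End empirical.

Definition limit_measures (R : realType) (X : pmetricType R) (f : X -> X)
    (x : X) : set (weak_star X) :=
  cluster ((fun n => empirical f x n : weak_star X) @ \oo).

Definition accumulation_basin (R : realType) (X : pmetricType R) (f : X -> X)
    (mu : probability (borel X) R) : set X :=
  [set x | limit_measures f x mu].

Definition invariant (R : realType) (X : pmetricType R) (f : X -> X)
    (mu : probability (borel X) R) : Prop :=
  forall A : set (borel X), measurable A -> mu (f @^-1` A) = mu A.

Definition ergodic (R : realType) (X : pmetricType R) (f : X -> X)
    (mu : probability (borel X) R) : Prop :=
  invariant f mu /\
  forall A : set (borel X), measurable A -> f @^-1` A = A ->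
    mu A = 0%E \/ mu A = 1%E.

Definition close_frequency (R : realType) (X : pmetricType R) (f : X -> X)
    (x y : X) (t : R) (n : nat) : \bar R :=
  (#|[pred j : 'I_n | mdist (iter j f x) (iter j f y) < t]|%:R / n%:R)%:E.

Definition DC1_scrambled (R : realType) (X : pmetricType R) (f : X -> X)
    (x y : X) : Prop :=
  (forall t : R, 0 < t -> limn_esup (close_frequency f x y t) = 1%E) /\
  (exists2 t0 : R, 0 < t0 & limn_einf (close_frequency f x y t0) = 0%E).

(* Main.v *)
(* The system is the one-sided subshift of {0,1}-sequences in which every run
   of n ones is followed by at least n^2 zeros before the next one.  Words can
   be concatenated after a padding by quadratically many zeros, and following
   a run of n ones by the point 0111... requires that many, so that every gap
   function is superlinear.  Take for mu and nu the Dirac measures at 111... and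
   000....  If mu is an accumulation point of the empirical measures of x and
   x has infinitely many zeros, then x has runs of ones filling a fixed
   proportion of an initial segment, of length r say; the r^2 zeros that follow
   then make nu an accumulation point as well.  Hence the points of
   G^mu \ G^nu eventually reach 111..., and any two of their orbits eventually
   coincide. *)

Require Import Defs.
From HB Require Import structures.
From mathcomp Require Import all_boot all_order all_algebra.
From mathcomp Require Import all_classical all_reals all_analysis.
From mathcomp Require Import measurable_realfun.
From mathcomp Require Import zify ring lra.

Set Implicit Arguments.
Unset Strict Implicit.
Unset Printing Implicit Defensive.

Import Order.TTheory GRing.Theory Num.Theory.
Import numFieldNormedType.Exports.

Local Open Scope classical_set_scope.

(** * Combinatorics of runs of ones and gluing of blocks *)

Section gapped_sequences.
Local Open Scope nat_scope.

(** Quantifying over all windows of ones ending at [j], not only maximal runs, makes shift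
    invariance immediate. Each instance reads finitely many symbols, so the condition is closed. *)
Definition gapped (x : nat -> bool) : Prop := forall i j l : nat,
  i <= j -> j < l -> (forall t, i <= t < j -> x t) -> ~~ x j -> x l ->
  (j - i) ^ 2 <= l - j.

Lemma gapped_eventually_ones (x : nat -> bool) (n : nat) :
  (forall t, n <= t -> x t) -> (forall t, x t -> n <= t) -> gapped x.
Proof.
move=> x1 x0 i j l ij jl xij xj xl.
have jn : j < n by rewrite ltnNge; apply: contra xj => /x1.
suff -> : i = j by rewrite subnn.
apply/eqP; rewrite eqn_leq ij leqNgt; apply/negP => /= ltij.
by have := x0 _ (xij i _); lia.
Qed.

Lemma gapped_zeros : gapped (fun=> false).
Proof. by move=> i j l. Qed.

Lemma gapped_shift (x : nat -> bool) : gapped x -> gapped (fun n => x n.+1).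
Proof.
move=> gx i j l ij jl xij xj xl.
rewrite -(subSS i j) -(subSS j l); apply: gx => //.
by case=> [|t] // it; apply: xij; lia.
Qed.

Lemma first_zero (x : nat -> bool) (i q : nat) : i <= q -> ~~ x q ->
  exists j, [/\ i <= j <= q, ~~ x j & forall t, i <= t < j -> x t].
Proof.
move=> iq xq; have ex : exists j, (i <= j) && ~~ x j by exists q; rewrite iq.
case: (ex_minnP ex) => j /andP[ij xj] jmin; exists j; split=> //.
  by rewrite ij jmin// iq.
move=> t /andP[it tj]; apply: contraLR tj => xt.
by rewrite -leqNgt jmin// it.
Qed.

(* The number of ones minus the number of zeros before [n] is at most the
   part of the last run of ones that is not yet compensated by the zeros
   following it. *)
Lemma excess_of_ones (x : nat -> bool) (n : nat) : gapped x ->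
  exists i r, [/\ i + r <= n, forall t, i <= t < i + r -> x t,
    forall t, i + r <= t < n -> ~~ x t &
    2 * \sum_(0 <= t < n) x t <= n + (r - (n - (i + r)))].
Proof.
move=> gx; elim: n => [|n [i [r [irn x1 x0 xn]]]].
  by exists 0, 0; split=> [//|t|t|]; rewrite ?big_geq//; lia.
rewrite big_nat_recr//=; case: (boolP (x n)) => [xn1|xn0]; last first.
  exists i, r; rewrite addn0; split=> //; [lia| |]; last by lia.
  move=> t tn; have [->//|tn'] := eqVneq t n; apply: x0; lia.
have [irn'|irn'] := eqVneq (i + r) n.
  exists i, r.+1; rewrite [_ + true]addn1; split; [lia| | |lia].
  - by move=> t ti; have [->//|tn'] := eqVneq t n; apply: x1; lia.
  - move=> t; lia.
(* A one after a gap opens a new run of length 1. By gappedness at least [r ^ 2 >= r] zeros have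
   followed the old run, so its excess is fully compensated. *)
exists n, 1; rewrite [_ + true]addn1; split; [lia| |move=> t; lia|].
  by move=> t tn; have -> : t = n by lia.
have xir : ~~ x (i + r) by apply: x0; lia.
have : (i + r - i) ^ 2 <= n - (i + r).
  by apply: gx => //; [lia|lia].
nia.
Qed.

(** A proportion 3/4 of ones forces the last run in [excess_of_ones] to have length at least
    [n / 2]. Followed to its end, possibly beyond [n], it has some length [r], and [r ^ 2] zeros
    come next, while the time elapsed before them is only linear in [r]. *)
Lemma long_runs (x : nat -> bool) (n : nat) : gapped x ->
    (forall N, exists2 q, N <= q & ~~ x q) ->
    3 * n <= 4 * \sum_(0 <= t < n) x t ->
  exists p r, [/\ n <= 2 * r, p <= 3 * r &
    forall t, p <= t < p + r ^ 2 -> ~~ x t].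
Proof.
move=> gx xz xn; have [i [r [irn x1 x0 xr]]] := excess_of_ones n gx.
have [q irq xq] := xz (i + r).
have [j [/andP[irj jq] xj xirj]] := first_zero irq xq.
have x1ij t : i <= t < j -> x t.
  move=> tij; have [tir|tir] := ltnP t (i + r); first by apply: x1; lia.
  by apply: xirj; lia.
exists j, (j - i); split; [lia|lia|].
move=> t tj; apply/negP => xt; have [tE|tE] := eqVneq t j.
  by rewrite tE (negbTE xj) in xt.
have : (j - i) ^ 2 <= t - j by apply: gx => //; lia.
lia.
Qed.

(* Blocks are glued by writing zeros between them. *)
Lemma gapped_glue (k K : nat) (x : nat -> nat -> bool) (a b : nat -> nat) :
    (forall i, gapped (x i)) ->
    (forall i, i < k -> a i <= b i) ->
    (forall i, i.+1 < k ->
      (b i - a i + 1 + K) ^ 2 + K + 1 <= a i.+1 - b i) ->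
  exists2 z, gapped z & forall i t, i < k -> a i <= t <= b i + K ->
    z t = x i (t - a i).
Proof.
move=> gx ab Mb.
have sep i i' : i < i' -> i' < k ->
    (b i - a i + 1 + K) ^ 2 + b i + K + 1 <= a i'.
  elim: i' => // i' IH; rewrite ltnS leq_eqVlt => /orP[/eqP <-|ii'] i'k.
    by have := Mb i i'k; lia.
  have := IH ii' (ltnW i'k); have := Mb i' i'k; have := ab i' (ltnW i'k); lia.
(* Each block is copied [K] symbols past [b i], so that iterates up to time [b i] still agree on
   further symbols. *)
pose inb i t := a i <= t <= b i + K.
have inb_inj i i' t : i < k -> i' < k -> inb i t -> inb i' t -> i = i'.
  rewrite /inb => ik i'k it i't; case: (ltngtP i i') => // ii'.
    by have := sep _ _ ii' i'k; lia.
  by have := sep _ _ ii' ik; lia.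
pose z t := [exists i : 'I_k, inb i t && x i (t - a i)].
have zE i t : i < k -> inb i t -> z t = x i (t - a i).
  move=> ik it; apply/existsP/idP => [[i' /andP[i't]]|xt].
    by rewrite (inb_inj i i' t).
  by exists (Ordinal ik); rewrite it.
have z_inb t : z t -> exists2 i, i < k & inb i t.
  by case/existsP => i /andP[it _]; exists i.
exists z => // i j l ij jl zij zj zl.
have [->|nij] := eqVneq i j; first by rewrite subnn.
have [u uk uj] : exists2 u, u < k & inb u j.-1.
  by apply: z_inb; apply: zij; lia.
have [v vk vl] := z_inb l zl.
(* A run of ones cannot enter block [u] from the left: the place before [a u] would carry a one,
   hence lie in another block, against [sep]. *)
have aui : a u <= i.
  rewrite leqNgt; apply/negP => iau.
  have [w wk wu] : exists2 w, w < k & inb w (a u).-1.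
    by apply: z_inb; apply: zij; rewrite /inb in uj; lia.
  rewrite /inb in uj wu.
  case: (ltngtP w u) => wu'; last by subst w; lia.
    by have := sep _ _ wu' uk; nia.
  by have := sep _ _ wu' wk; lia.
rewrite /inb in uj vl.
have := ab u uk.
(* Within one block, gappedness of [x u] applies. If [l] is in a later block, the run fits in block
   [u], and [sep] leaves room for its square; [j] may be as large as [b u + K + 1]. *)
case: (ltngtP u v) => uv abu; last 1 first.
- subst v.
  have -> : l - j = (l - a u) - (j - a u) by lia.
  have -> : j - i = (j - a u) - (i - a u) by lia.
  apply: (gx u); [lia|lia| | |].
  + move=> t tij; have := zij (t + a u).
    rewrite (zE u)//; last by rewrite /inb; lia.
    by rewrite addnK; apply; lia.
  + by rewrite -zE// /inb; lia.
  + by rewrite -zE// /inb; lia.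
- have := sep _ _ uv vk.
  have : (j - i) ^ 2 <= (b u - a u + 1 + K) ^ 2 by rewrite leq_sqr; lia.
  lia.
- by have := sep _ _ uv uk; lia.
Qed.

End gapped_sequences.

Local Open Scope ring_scope.

(** * The first-difference metric on binary sequences *)

Section first_difference_metric.
Context {R : realType}.
Implicit Types x y z : nat -> bool.

Definition seq_dist x y : R :=
  if pselect (exists n, x n != y n) is left ex then (ex_minn ex).+1%:R^-1
  else 0.

Lemma seq_dist_lt x y n :
  seq_dist x y < n.+1%:R^-1 <-> forall k, (k <= n)%N -> x k = y k.
Proof.
rewrite /seq_dist; case: pselect => [ex|nex]; last first.
  split=> [_ k _|_]; last by rewrite invr_gt0.
  by apply/eqP/negPn/negP => xyk; apply: nex; exists k.
case: ex_minnP => m xym mmin.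
rewrite ltf_pV2 ?posrE ?ltr0n// ltr_nat ltnS; split=> [nm k kn|xy].
  apply/eqP/negPn/negP => /mmin; lia.
by rewrite ltnNge; apply/negP => /xy /eqP; rewrite (negbTE xym).
Qed.

Lemma seq_dist_le x y n :
  seq_dist x y <= n.+1%:R^-1 <-> forall k, (k < n)%N -> x k = y k.
Proof.
rewrite /seq_dist; case: pselect => [ex|nex]; last first.
  split=> [_ k _|_]; last by rewrite invr_ge0.
  by apply/eqP/negPn/negP => xyk; apply: nex; exists k.
case: ex_minnP => m xym mmin.
rewrite lef_pV2 ?posrE ?ltr0n// ler_nat ltnS; split=> [nm k kn|xy].
  apply/eqP/negPn/negP => /mmin; lia.
by rewrite leqNgt; apply/negP => /xy /eqP; rewrite (negbTE xym).
Qed.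

Lemma seq_dist_ge0 x y : 0 <= seq_dist x y.
Proof. by rewrite /seq_dist; case: pselect => // ex; rewrite invr_ge0. Qed.

Lemma seq_dist_eq0 x y : seq_dist x y = 0 -> x = y.
Proof.
move=> xy0; apply/funext => n.
by have /seq_dist_lt : seq_dist x y < n.+1%:R^-1; [rewrite xy0 invr_gt0|exact].
Qed.

(** Bounding over every disagreement avoids reasoning about the first one. *)
Lemma seq_dist_le_sub x y c : 0 <= c ->
  (forall n, x n != y n -> n.+1%:R^-1 <= c) -> seq_dist x y <= c.
Proof.
rewrite /seq_dist; case: pselect => // ex c0; apply.
by case: ex_minnP.
Qed.

Lemma seq_dist_ge x y n : x n != y n -> n.+1%:R^-1 <= seq_dist x y.
Proof.
by move=> xyn; rewrite leNgt; apply/negP => /seq_dist_lt/(_ n (leqnn n))/eqP;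
  rewrite (negbTE xyn).
Qed.

Lemma seq_distxx x : seq_dist x x = 0.
Proof.
apply/eqP; rewrite eq_le seq_dist_ge0 andbT.
by apply: seq_dist_le_sub => // n; rewrite eqxx.
Qed.

Lemma seq_distC x y : seq_dist x y = seq_dist y x.
Proof.
by apply/eqP; rewrite eq_le; apply/andP; split; apply: seq_dist_le_sub;
  rewrite ?seq_dist_ge0// => n; rewrite eq_sym => /seq_dist_ge.
Qed.

(** Where [x] and [z] disagree, [y] disagrees with one of them. *)
Lemma seq_dist_triangle y x z : seq_dist x z <= seq_dist x y + seq_dist y z.
Proof.
apply: seq_dist_le_sub => [|n xzn]; first by rewrite addr_ge0// seq_dist_ge0.
have [xyn|/seq_dist_ge xyn] := eqVneq (x n) (y n).
  rewrite xyn in xzn.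
  by rewrite (le_trans (seq_dist_ge xzn))// lerDr seq_dist_ge0.
by rewrite (le_trans xyn)// lerDl seq_dist_ge0.
Qed.

End first_difference_metric.

(* The parameter [R] makes the metric canonical on the type. *)
Definition gapshift (R : realType) : Type := {x : nat -> bool | gapped x}.

HB.instance Definition _ (R : realType) := gen_eqMixin (gapshift R).
HB.instance Definition _ (R : realType) := gen_choiceMixin (gapshift R).
HB.instance Definition _ (R : realType) :=
  isPointed.Build (gapshift R) (exist _ _ gapped_zeros).

(** * The subshift as a compact metric system *)

Section gapshift_metric.
Context (R : realType).

Lemma gapshift_ext (x y : gapshift R) : sval x = sval y -> x = y.
Proof. by case: x y => [x gx] [y gy] /= xy; exact: eq_exist. Qed.

Let dist (x y : gapshift R) : R := seq_dist (sval x) (sval y).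

HB.instance Definition _ := @isMetric.Build R (gapshift R) dist
  (fun x => seq_distxx (sval x))
  (fun x y xy => gapshift_ext (seq_dist_eq0 xy))
  (fun x y => seq_distC (sval x) (sval y))
  (fun y x z => seq_dist_triangle (sval y) (sval x) (sval z)).

Lemma gapshift_distE (x y : gapshift R) :
  mdist x y = seq_dist (sval x) (sval y).
Proof. by []. Qed.

Lemma gapshift_nbhsP (x : gapshift R) (U : set (gapshift R)) :
  nbhs x U <->
  exists n, forall y, (forall k, (k <= n)%N -> sval x k = sval y k) -> U y.
Proof.
rewrite -nbhs_ballE; split=> [[e /= e0 xeU]|[n nU]].
  have [n ne] : exists n, n.+1%:R^-1 < e.
    exists (Num.truncn e^-1).
    by rewrite -[ltRHS]invrK ltf_pV2 ?posrE ?invr_gt0 ?ltr0n// truncnS_gt.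
  exists n => y /seq_dist_lt xy; apply: xeU.
  by rewrite ballEmdist/= gapshift_distE (lt_trans (xy _)).
exists n.+1%:R^-1 => /=; first by rewrite invr_gt0.
by move=> y; rewrite ballEmdist/= gapshift_distE => /seq_dist_lt/nU.
Qed.

(** The gapped sequences form a closed subset of the Cantor space, and the subshift is its
    continuous image. *)
Lemma gapshift_compact : compact [set: gapshift R].
Proof.
pose K : set cantor_space := [set x : cantor_space | gapped (x : nat -> bool)].
have cylP (x : cantor_space) n :
    nbhs x [set y : cantor_space | forall k, (k < n)%N -> x k = y k].
  elim: n => [|n IH]; first by apply: filterS filterT => y _ k.
  have xn : nbhs x [set y : cantor_space | y n = x n].
    exact: (@proj_continuous nat (fun=> bool) n x _ (discrete_set1 (x n))).
  apply: filterS2 IH xn => y xy xyn k; rewrite ltnS leq_eqVlt.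
  by case/orP => [/eqP ->//|/xy].
have clK : closed K.
  move=> x clx i j l ij jl xij xj xl.
  have [y [gy xy]] := clx _ (cylP x l.+1).
  by apply: gy => // [t tij||]; rewrite -xy//; [exact: xij|lia..].
have cK : compact K.
  by apply: subclosed_compact clK cantor_space_compact _.
(* The default [point] outside [K] is harmless: continuity is only claimed on [K]. *)
pose g (x : cantor_space) : gapshift R :=
  if pselect (gapped x) is left gx then exist _ _ gx else point.
have gE (x : cantor_space) : gapped x -> sval (g x) = x.
  by rewrite /g; case: pselect.
have -> : [set: gapshift R] = g @` K.
  by apply/seteqP; split=> // -[x gx] _; exists x => //; apply/gapshift_ext/gE.
apply: continuous_compact => //; apply/subspace_continuousP => x Kx U.
move=> /gapshift_nbhsP[n nU].
have xn := cylP x n.+1.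
rewrite /nbhs/= /within/=; apply: filterS xn => y xy Ky; apply: nU => k kn.
by rewrite !gE//; exact: xy.
Qed.

Definition gapshift_map (x : gapshift R) : gapshift R :=
  exist _ _ (gapped_shift (svalP x)).

Lemma gapshift_map_continuous : continuous gapshift_map.
Proof.
move=> x U /gapshift_nbhsP[n nU]; apply/gapshift_nbhsP; exists n.+1 => y xy.
by apply: nU => k kn; apply: xy.
Qed.

Lemma iter_gapshift_map n (x : gapshift R) k :
  sval (iter n gapshift_map x) k = sval x (n + k)%N.
Proof. by elim: n k => //= n IH k; rewrite IH addnS. Qed.

Definition zeros : gapshift R := exist _ _ gapped_zeros.

(** The sequence [0^n 1^oo]: [leq n] tests [n <= t]. *)
Definition ones_from (n : nat) : gapshift R :=
  exist _ (leq n) (@gapped_eventually_ones (leq n) n (fun _ => id) (fun _ => id)).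

End gapshift_metric.

(** * Specification with infinite gap rate *)

Section gapshift_specification.
Context (R : realType).
Local Notation f := (@gapshift_map R).

(** The gap required by [gapped_glue] for [K = truncn eps^-1]: agreement on [K] symbols means
    distance at most [1 / (K + 1) <= eps]. *)
Definition gapshift_gap (n : nat) (eps : R) : nat :=
  (n + Num.truncn eps^-1) ^ 2 + Num.truncn eps^-1 + 1.

Lemma gapshift_gap_function : gap_function gapshift_gap.
Proof.
rewrite /gapshift_gap; split=> [n eps _ _|m n eps _ mn _|n e1 e2 n0 e10 e12].
- by rewrite addn1.
- by rewrite !leq_add2r leq_sqr leq_add2r.
- have : (Num.truncn e2^-1 <= Num.truncn e1^-1)%N.
    by apply: le_truncn; rewrite lef_pV2 ?posrE// (lt_le_trans e10).
  by move=> le21; rewrite leq_add2r leq_add// leq_sqr leq_add2l.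
Qed.

Lemma gapshift_nonuniform_specification :
  nonuniform_specification f gapshift_gap.
Proof.
split=> [|eps k x a b eps0 _ ab _ Mb]; first exact: gapshift_gap_function.
have [z gz zE] := gapped_glue (fun i => svalP (x i)) ab Mb.
exists (exist _ z gz) => i n ik /andP[ain nbi].
set K := Num.truncn eps^-1 in zE Mb.
have Keps : K.+1%:R^-1 <= eps.
  rewrite -[leRHS]invrK lef_pV2 ?posrE ?invr_gt0 ?ltr0n//.
  by rewrite ltW// truncnS_gt.
rewrite gapshift_distE (le_trans _ Keps)//; apply/seq_dist_le => s sK.
rewrite !iter_gapshift_map /= (zE i)//; first by congr (sval (x i) _); lia.
by apply/andP; split; lia.
Qed.

(* Shadow [1^oo] on [0, n) and then [0 1^oo] on two symbols. *)
Lemma gapshift_gap_lower_bound (M : nat -> R -> nat) (n : nat) :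
  nonuniform_specification f M -> (0 < n)%N -> (n ^ 2 <= M n 2^-1)%N.
Proof.
move=> [[Mpos _ _] Mspec] n0.
have half0 : (0 : R) < 2^-1 by rewrite invr_gt0.
set m := M n 2^-1; have m0 : (0 < m)%N by exact: Mpos.
pose x i := ones_from R (if i is 0 then 0 else 1)%N.
pose a i := (if i is 0 then 0 else n.-1 + m)%N.
pose b i := (if i is 0 then n.-1 else n + m)%N.
have [|||z zx] := Mspec 2^-1 2%N x a b half0 isT.
- by case=> [|i] _ //=; rewrite /a /b; lia.
- by case=> [|i] //= _; rewrite /a /b; lia.
- case=> [|i] //= _; rewrite /a /b subn0.
  by rewrite (_ : (n.-1 + 1 = n)%N) -/m; lia.
(* Distance at most 1/2 forces agreement on the current symbol. *)
have zE i t : (i < 2)%N -> (a i <= t <= b i)%N ->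
    sval z t = sval (x i) (t - a i)%N.
  move=> i2 /(zx _ _ i2); rewrite gapshift_distE => /seq_dist_le/(_ 0%N isT).
  by rewrite !iter_gapshift_map !addn0 => ->.
have z1 t : (t < n)%N -> sval z t.
  by move=> tn; rewrite (zE 0%N)// /a /b; lia.
have z0 : ~~ sval z (n.-1 + m)%N.
  by rewrite (zE 1%N)// /a /b ?subnn//; lia.
have zl : sval z (n + m)%N.
  rewrite (zE 1%N)// /a /b; last lia.
  by rewrite /x /=; lia.
(* The run starting at time 0 ends at a first zero [j >= n], and the one at [n + m] must come at
   least [j ^ 2] places later. *)
have [||j [/andP[nj jm] zj znj]] := @first_zero (sval z) n (n.-1 + m)%N.
- lia.
- by [].
have : ((j - 0) ^ 2 <= n + m - j)%N.
  apply: (svalP z) => //; first lia.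
  move=> t /andP[_ tj]; have [/z1//|nt] := ltnP t n; apply: znj; lia.
nia.
Qed.

(** The single scale [eps = 1/2] suffices: there the ratio is at least [n]. *)
Lemma gapshift_gap_rate (M : nat -> R -> nat) :
  nonuniform_specification f M -> gap_rate M = +oo%E.
Proof.
move=> Mspec; apply/eqP; rewrite -leye_eq; apply: ereal_sup_ubound.
exists 2^-1 => /=; first by rewrite invr_gt0.
apply: (cvg_limn_einf_sup _).1; apply/cvgeryP/cvgryPge => A.
near=> n.
have n0 : (0 < n)%N by near: n; exact: nbhs_infty_gt.
rewrite ler_pdivlMr ?ltr0n//; apply: (@le_trans _ _ (n ^ 2)%:R).
  rewrite expnS expn1 natrM ler_pM2r ?ltr0n//.
  by near: n; exact: nbhs_infty_ger.
by rewrite ler_nat; exact: gapshift_gap_lower_bound.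
Unshelve. all: end_near. Qed.

Lemma gapshift_infinite_specification :
  nonuniform_tau_specification f +oo%E.
Proof.
split=> [|M /gapshift_gap_rate ->//]; exists gapshift_gap.
have spec := gapshift_nonuniform_specification.
by split=> //; exact: gapshift_gap_rate.
Qed.

End gapshift_specification.

(** * Empirical averages and weak* accumulation points *)

Section empirical_integrals.
Context (R : realType) (X : pmetricType R) (f : X -> X).

Lemma continuous_borel_measurable (phi : X -> R) :
  continuous phi -> measurable_fun [set: borel X] phi.
Proof.
move=> /continuousP cphi; apply: (measurability _ (RGenOpens.measurableE R)).
move=> _ [_ [a [b ->] <-]]; rewrite setTI.
by apply: sub_sigma_algebra; exact/cphi/interval_open.
Qed.

Lemma integral_functional_dirac (a : X) (phi : continuousType X R) :
  integral_functional (\d_(a : borel X)) phi = phi a.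
Proof.
rewrite /integral_functional /Rintegral integral_dirac//.
  by rewrite diracT mul1e.
apply/measurable_EFinP.
exact: (continuous_borel_measurable (@cts_fun _ _ phi)).
Qed.

(** The nonnegative case; the general one splits [phi] into positive and negative parts. *)
Lemma integral_empirical_ge0 (x : X) (n : nat) (g : X -> R) :
  measurable_fun [set: borel X] g -> (forall y, 0 <= g y) ->
  (\int[empirical f x n]_y (g y)%:E =
    (n.+1%:R^-1 * \sum_(k < n.+1) g (iter k f x))%:E)%E.
Proof.
move=> /measurable_EFinP mg g0; rewrite ge0_integral_mscale//=; last first.
  by move=> y _; rewrite lee_fin.
rewrite ge0_integral_measure_sum//=; last by move=> y _; rewrite lee_fin.
rewrite EFinM -sumEFin; congr (_ * _)%E; apply: eq_bigr => k _.
by rewrite integral_dirac//= diracT mul1e.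
Qed.

Lemma integral_functional_empirical (x : X) (n : nat)
    (phi : continuousType X R) :
  integral_functional (empirical f x n) phi =
  n.+1%:R^-1 * \sum_(k < n.+1) phi (iter k f x).
Proof.
have mphi := continuous_borel_measurable (@cts_fun _ _ phi).
rewrite /integral_functional /Rintegral integralE.
rewrite [X in X^\+%E](_ : _ = EFin \o (phi : borel X -> R))//.
rewrite [X in X^\-%E](_ : _ = EFin \o (phi : borel X -> R))//.
rewrite funerpos funerneg /=.
rewrite !integral_empirical_ge0//; last 2 first.
- exact: measurable_funrneg.
- exact: measurable_funrpos.
rewrite -EFinB /= -mulrBr -sumrB; congr (_ * _); apply: eq_bigr => k _.
by rewrite -[in RHS](funrposBneg phi).
Qed.

(** The topology is initial for a map into a product, where convergence is coordinatewise. *)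
Lemma weak_star_cvg (F : set_system (weak_star X)) (mu : weak_star X) :
  Filter F ->
  (forall phi : continuousType X R,
    integral_functional m phi @[m --> F] --> integral_functional mu phi) ->
  F --> mu.
Proof.
move=> FF Fmu U [_ [[C oC <-] Cmu CU]].
have cvgC : {ptws, (@integral_functional R X) @ F --> integral_functional mu}.
  apply/cvg_sup => phi V [_ [[D oD <-] Dmu DV]].
  by apply: (filterS DV); apply: (Fmu phi); exact: open_nbhs_nbhs.
by apply: (filterS CU); apply: cvgC; exact: open_nbhs_nbhs.
Qed.

Lemma weak_star_near_lt (mu : weak_star X) (phi : continuousType X R) (c : R) :
  c < integral_functional mu phi ->
  \forall m \near mu, c < integral_functional (m : weak_star X) phi.
Proof.
move=> cmu.
have cint : {for mu, continuous (@integral_functional R X : weak_star X -> _)}.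
  exact: initial_continuous.
have cphi := @proj_continuous (continuousType X R) (fun=> R) phi
  (integral_functional mu).
have cU := cphi [set r | c < r] (lt_nbhsr cmu).
exact: (cint _ cU).
Qed.

Lemma accumulation_lt (x : X) (mu : probability (borel X) R)
    (phi : continuousType X R) (c : R) (N : nat) :
  limit_measures f x mu -> c < integral_functional mu phi ->
  exists2 n, (N <= n)%N & c < integral_functional (empirical f x n) phi.
Proof.
move=> xmu /weak_star_near_lt muU.
have tailF : ((fun n => empirical f x n : weak_star X) @ \oo)
    [set (empirical f x n : weak_star X) | n in [set n | (N <= n)%N]].
  by exists N => // n Nn; exists n.
by have [_ [[n Nn <-] cn]] := xmu _ _ tailF muU; exists n.
Qed.

(** [T] need not be monotone: a limit along times tending to infinity is a cluster point. *)
Lemma limit_measures_subsequence (x : X) (T : nat -> nat)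
    (mu : probability (borel X) R) :
  T @ \oo --> \oo ->
  (forall phi : continuousType X R,
    integral_functional (empirical f x (T n)) phi @[n --> \oo] -->
    integral_functional mu phi) ->
  limit_measures f x mu.
Proof.
move=> Too phiT.
have cvgT : (fun n => empirical f x (T n) : weak_star X) @ \oo -->
    (mu : weak_star X).
  exact: weak_star_cvg.
move=> A B /Too TA /cvgT TB.
have /filter_ex[n [An Bn]] : \forall n \near \oo,
    A (empirical f x (T n)) /\ B (empirical f x (T n)).
  by apply: filterI; [exact: TA|exact: TB].
by exists (empirical f x (T n) : weak_star X).
Qed.

End empirical_integrals.

(** * Dirac measures at fixed points and as limits *)

Section dirac_limits.
Context (R : realType) (X : pmetricType R) (f : X -> X).

Lemma dirac_ergodic (a : X) : f a = a ->
  ergodic f (\d_(a : borel X) : probability (borel X) R).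
Proof.
move=> fa; split=> [A _|A _ _]; rewrite /= !diracE.
  by congr (_%:R%:E); congr nat_of_bool; apply/idP/idP => /[!inE] /=;
    rewrite fa.
by case: (a \in A); [right|left].
Qed.

(** Times spent near [a] change the average of [phi] little, and the other times have vanishing
    frequency while [phi] is bounded by compactness. *)
Lemma limit_measures_dirac (x a : X) (T : nat -> nat) :
  compact [set: X] -> T @ \oo --> \oo ->
  (forall U : set X, nbhs a U ->
    (\sum_(0 <= k < (T n).+1) ~~ `[< U (iter k f x) >])%N%:R / (T n).+1%:R
      @[n --> \oo] --> (0 : R)) ->
  limit_measures f x (\d_(a : borel X) : probability (borel X) R).
Proof.
move=> cX Too TU; apply: (limit_measures_subsequence Too) => phi.
have cphi : continuous phi by exact: cts_fun.
rewrite integral_functional_dirac.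
under eq_fun do rewrite integral_functional_empirical.
have [C C0 phiC] : exists2 C : R, 0 < C & forall y, `|phi a - phi y| <= C.
  have : compact (phi @` [set: X]).
    by apply: continuous_compact => //; exact: continuous_subspaceT.
  move=> /compact_bounded[B [_ /(_ (`|B| + 1))]].
  rewrite ltr_pwDr ?ler_norm// => /(_ isT) phiB.
  exists (`|B| + 1 + (`|B| + 1)) => [|y].
    by apply: addr_gt0; exact: ltr_wpDl.
  rewrite (le_trans (ler_normB _ _))// lerD//; apply: phiB.
    by exists a.
  by exists y.
apply/cvgrPdist_le => e e0.
pose U := [set y | `|phi a - phi y| <= e / 2].
have aU : nbhs a U.
  have /cvgrPdist_le := cphi a; apply; exact: divr_gt0.
(* Each bad time costs at most [C], so this frequency keeps their total share below [e / 2]. *)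
have /cvgrPdist_le/(_ (e / 2 / C)) := TU U aU.
rewrite divr_gt0 ?divr_gt0// => /(_ isT); apply: filterS => n.
rewrite sub0r normrN ger0_norm ?divr_ge0// => bad.
set N := (T n).+1 in bad *.
have N0 : (0 : R) < N%:R by rewrite ltr0n.
have -> : phi a - N%:R^-1 * \sum_(k < N) phi (iter k f x) =
    N%:R^-1 * \sum_(k < N) (phi a - phi (iter k f x)).
  rewrite sumrB sumr_const card_ord mulrBr; congr (_ - _).
  by rewrite -[phi a *+ N]mulr_natl mulrA mulVf ?mul1r// lt0r_neq0.
rewrite normrM gtr0_norm ?invr_gt0// mulrC ler_pdivrMr//.
rewrite (le_trans (ler_norm_sum _ _ _))//.
apply: (@le_trans _ _
    (\sum_(k < N) (e / 2 + C * (~~ `[< U (iter k f x) >])%:R))).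
  apply: ler_sum => k _; case: asboolP => [Uk|_] /=.
    by rewrite mulr0 addr0.
  by rewrite mulr1 (le_trans (phiC _))// lerDr ltW// divr_gt0.
rewrite big_split/= sumr_const card_ord -mulr_sumr -natr_sum.
rewrite ler_pdivrMr// in bad.
rewrite -(big_mkord predT (fun k => (~~ `[< U (iter k f x) >] : nat))).
rewrite -[_ *+ N]mulr_natr [leRHS](_ : _ = e / 2 * N%:R + C * (e / 2 / C * N%:R)).
  by rewrite lerD2l ler_pM2l.
by field; rewrite lt0r_neq0.
Qed.

End dirac_limits.

(** * Eventually coinciding orbits are not scrambled *)

Section eventually_equal_orbits.
Context (R : realType) (X : pmetricType R) (f : X -> X).

(** For [n > 2 * N] at least half of the first [n] times have equal iterates, so no lower frequency
    of closeness vanishes. *)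
Lemma eventually_equal_not_DC1 (x y : X) (N : nat) :
  iter N f x = iter N f y -> ~ DC1_scrambled f x y.
Proof.
move=> xyN [_ [t t0]].
have xy j : (N <= j)%N -> iter j f x = iter j f y.
  by move=> Nj; rewrite -(subnK Nj) !iterD xyN.
suff : (2^-1%:E <= limn_einf (close_frequency f x y t))%E.
  by move=> + lim0; rewrite lim0 lee_fin leNgt invr_gt0 ltr0n.
have -> : limn_einf (close_frequency f x y t) =
    limf_einf (close_frequency f x y t) \oo by [].
rewrite limf_einfE; apply: le_ereal_sup_tmp.
exists (ereal_inf (close_frequency f x y t @` [set n | (2 * N < n)%N])).
  exists [set n | (2 * N < n)%N] => //; exact: nbhs_infty_gt.
apply: le_ereal_inf_tmp => _ [n /= Nn <-]; rewrite lee_fin.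
have n0 : (0 : R) < n%:R by rewrite ltr0n; lia.
rewrite ler_pdivlMr// ler_pdivrMl// -natrM ler_nat.
set A := [pred j : 'I_n | _].
have : (n - N <= #|A|)%N.
  rewrite -[X in (X <= _)%N]muln1 -sum_nat_const_nat big_geq_mkord sum1_card.
  apply: subset_leq_card; apply/fintype.subsetP => j /= Nj.
  by rewrite !inE xy// mdistxx.
lia.
Qed.

End eventually_equal_orbits.

(** * Basins of the two fixed points of the subshift *)

Section gapshift_measures.
Context (R : realType).
Local Notation f := (@gapshift_map R).
Local Notation X := (gapshift R).

(** A test function whose empirical averages are frequencies of ones. *)
Definition first_symbol (x : X) : R := (sval x 0%N)%:R.

Lemma first_symbol_continuous : continuous first_symbol.
Proof.
move=> x U /nbhs_singleton Ux; apply/gapshift_nbhsP; exists 0%N => y xy.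
by rewrite /= /first_symbol -xy.
Qed.

Lemma gapshift_map_zeros : f (zeros R) = zeros R.
Proof. exact: gapshift_ext. Qed.

Lemma gapshift_map_ones : f (ones_from R 0) = ones_from R 0.
Proof. exact: gapshift_ext. Qed.

Lemma gapshift_long_zeros (x : X) :
    (forall N, exists2 q, (N <= q)%N & ~~ sval x q) ->
    limit_measures f x (\d_(ones_from R 0 : borel X) : probability (borel X) R) ->
  forall n, exists p r, [/\ (n < r)%N, (p <= 3 * r)%N &
    forall t, (p <= t < p + r ^ 2)%N -> ~~ sval x t].
Proof.
move=> xz xmu n.
pose phi : continuousType X R := mkcts first_symbol_continuous.
(* The level 3/4 is the one [long_runs] needs. Index [N] averages [N.+1] symbols, and
   [N >= 2 * n.+1] turns [N.+1 <= 2 * r] into [n < r]. *)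
have [|N nN] := @accumulation_lt _ _ _ _ _ phi (3 / 4) (2 * n.+1) xmu.
  by rewrite integral_functional_dirac /= /mkcts /first_symbol /=; lra.
rewrite integral_functional_empirical ltr_pdivlMl ?ltr0n// => ltN.
have [|p [r [Nr pr xpr]]] := @long_runs (sval x) N.+1 (svalP x) xz.
- rewrite big_mkord -(ler_nat R) !natrM natr_sum.
  rewrite (eq_bigr (fun k : 'I_N.+1 => phi (iter k f x))) => [|k _]; last first.
    by rewrite /phi /= /mkcts /first_symbol iter_gapshift_map addn0.
  by rewrite ltW//; lra.
by exists p, r; split=> //; lia.
Qed.

Lemma gapshift_zeros_limit (x : X) :
    (forall N, exists2 q, (N <= q)%N & ~~ sval x q) ->
    limit_measures f x (\d_(ones_from R 0 : borel X) : probability (borel X) R) ->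
  limit_measures f x (\d_(zeros R : borel X) : probability (borel X) R).
Proof.
move=> xz xmu; have := gapshift_long_zeros xz xmu.
move=> /choice[p /choice[r /all_and3[nr pr xpr]]].
(* The predecessor makes the empirical measure stop exactly at the end of the block of zeros. *)
pose T n := (p n + r n ^ 2).-1.
have TS n : (T n).+1 = (p n + r n ^ 2)%N by have := nr n; rewrite /T; nia.
have nT n : (n <= T n)%N by have := TS n; have := nr n; nia.
apply: (@limit_measures_dirac _ _ _ _ _ T).
- exact: gapshift_compact.
- move=> U [N _ NU]; exists N => // n /= Nn; apply: NU => /=.
  exact: leq_trans (nT n).
move=> U /gapshift_nbhsP[L LU].
pose bad k := ~~ `[< U (iter k f x) >].
have good n k : (p n <= k)%N -> (k + L < p n + r n ^ 2)%N -> bad k = false.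
  move=> pk kL; apply/negbTE; rewrite negbK; apply/asboolP/LU => s sL.
  by rewrite iter_gapshift_map; apply/esym/negbTE/(xpr n); lia.
(* Bad times occur only before the zeros or among the last [L] times, where the window of [L + 1]
   symbols leaves the block. *)
have sum_bad n : (\sum_(0 <= k < (T n).+1) bad k <= p n + L)%N.
  have triv a b : (\sum_(a <= k < b) bad k <= b - a)%N.
    rewrite -[leqRHS]muln1 -sum_nat_const_nat; apply: leq_sum => k _.
    exact: leq_b1.
  have [pL|pL] := leqP (T n).+1 (p n + L).
    by rewrite (leq_trans (triv _ _))// subn0.
  rewrite (@big_cat_nat _ _ _ (p n))//=; last lia.
  rewrite (@big_cat_nat _ _ _ ((T n).+1 - L) (p n))//=; [|lia|lia].
  rewrite [X in (_ + (X + _))%N]big_nat_cond.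
  rewrite [X in (_ + (X + _))%N]big1 => [|k]; last first.
    by rewrite andbT => kp; rewrite (good n)//; have := TS n; lia.
  rewrite add0n (leq_trans (leq_add (triv _ _) (triv _ _)))//; lia.
(* With [p <= 3 * r] and [n < r], the bad frequency is at most
   [(3 * r + L) / r ^ 2 <= (3 + L) / (n + 1)]. *)
apply: (@squeeze_cvgr _ _ _ _ (fun=> 0) (fun n => (3 + L)%:R * n.+1%:R^-1)).
- near=> n; rewrite divr_ge0//= TS.
  have r0 : (0 < r n)%N by have := nr n; lia.
  rewrite ler_pdivrMr ?ltr0n; last nia.
  rewrite mulrAC ler_pdivlMr ?ltr0n// -!natrM ler_nat.
  have := sum_bad n; have := nr n; have := pr n; rewrite TS/=.
  set S := (\sum_(_ <= _ < _) _)%N => ? ? ?.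
  apply: (@leq_trans ((3 * r n + L) * r n)); first by apply: leq_mul; lia.
  nia.
- exact: cvg_cst.
- rewrite -[X in _ --> X](mulr0 (3 + L)%:R); apply: cvgMr.
  exact: cvg_harmonic.
Unshelve. all: end_near. Qed.

(** Otherwise zeros recur forever, and [gapshift_zeros_limit] contradicts the exclusion of the
    second basin. *)
Lemma gapshift_eventually_ones (x : X) :
  (accumulation_basin f (\d_(ones_from R 0 : borel X) : probability (borel X) R)
   `\` accumulation_basin f (\d_(zeros R : borel X) : probability (borel X) R)) x ->
  exists N, forall n, (N <= n)%N -> iter n f x = ones_from R 0.
Proof.
move=> [xmu xnu]; apply: contrapT => nex; apply: xnu.
apply: gapshift_zeros_limit xmu => N; apply: contrapT => nq; apply: nex.
exists N => n Nn; apply/gapshift_ext/funext => k; rewrite iter_gapshift_map.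
apply/negPn/negP => xnk; apply: nq; exists (n + k)%N => //.
exact: leq_trans Nn (leq_addr _ _).
Qed.

End gapshift_measures.

(* The library's measures are set functions defined on all subsets, so that
   distinctness is inequality on some measurable set. *)
Theorem theorem3 (R : realType) :
  exists (X : pmetricType R) (f : X -> X),
    [/\ dynamical_system f,
        nonuniform_tau_specification f +oo%E &
        exists mu nu : probability (borel X) R,
          [/\ ergodic f mu,
              ergodic f nu,
              exists2 A : set (borel X), measurable A & mu A <> nu A &
              forall x y : X,
                (accumulation_basin f mu `\` accumulation_basin f nu) x ->
                (accumulation_basin f mu `\` accumulation_basin f nu) y ->
                ~ DC1_scrambled f x y]].
Proof.
exists (gapshift R), (@gapshift_map R); split.
- split; first exact: gapshift_compact.
    by exists (zeros R), (ones_from R 0) => /(congr1 sval)/(congr1 (@^~ 0%N)).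
  exact: gapshift_map_continuous.
- exact: gapshift_infinite_specification.
exists (\d_(ones_from R 0 : borel (gapshift R))).
exists (\d_(zeros R : borel (gapshift R))); split.
- exact/dirac_ergodic/gapshift_map_ones.
- exact/dirac_ergodic/gapshift_map_zeros.
(* This cylinder is open and contains [1^oo] but not [0^oo]. *)
- exists [set x : gapshift R | sval x 0%N].
    apply: sub_sigma_algebra; rewrite /= openE => x x0.
    by apply/gapshift_nbhsP; exists 0%N => y xy; rewrite /= -xy.
  rewrite /= !diracE mem_set// memNset//= => /eqP.
  by rewrite eqe oner_eq0.
move=> x y /gapshift_eventually_ones[N xN] /gapshift_eventually_ones[N' yN].
apply: (@eventually_equal_not_DC1 _ _ _ _ _ (maxn N N')).
by rewrite xN ?leq_maxl// yN// leq_maxr.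
Qed.
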